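(* Let $\sigma$ be a surjective endomorphism of $(X,\mathcal B,\mu)$ with $\mu$ quasi-invariant with respect to $\sigma$, and let $\nu$ be a measure with $d\nu(x)=h(x)\,d\mu(x)$, where $h(x)>0$ for $\mu$-a.e. $x$. Let $\psi\in M(\sigma,\nu)$ and $\varphi\in M(\sigma,\mu)$. Then $$\mathbb E_\sigma(h)\,\psi=\varphi\,(h\circ\sigma).$$ Hence this relation establishes a one-to-one correspondence between the sets of Markovian functions $M(\sigma,\mu)$ and $M(\sigma,\nu)$.
   Context: $(X,\mathcal B)$ is a standard Borel space, measures are non-atomic Borel probability measures on it, and $\sigma:X\to X$ is a measurable surjection. Quasi-invariance means $\mu(A)=0\Leftrightarrow\mu(\sigma^{-1}(A))=0$ for $A\in\mathcal B$. $\sigma^{-1}(\mathcal B)=\{\sigma^{-1}(B):B\in\mathcal B\}$, and $\mathbb E_\sigma$ is the conditional expectation, with respect to $\mu$, onto $\sigma^{-1}(\mathcal B)$-measurable functions. For a measure $\lambda$ on $(X,\mathcal B)$, $M(\sigma,\lambda)$ is the set of Markovian functions, i.e. Borel functions $\varphi$ satisfying $\int_X(f\circ\sigma)\varphi\,d\lambda=\int_Xf\,d\lambda$ for all $f\in L^1(\lambda)$. Equalities of functions are understood almost everywhere.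
   Formalization: The Markovian functions in M(σ,μ) and M(σ,ν) are additionally required to be almost everywhere equal to a σ^{-1}(B)-measurable function; without this the identity fails, e.g. for the doubling map with h=1, φ=1, ψ=1±1. *)

(* Defs.v *)
From HB Require Import structures.
From mathcomp Require Import all_boot all_order all_algebra.
From mathcomp Require Import all_classical all_reals all_analysis.

Set Implicit Arguments.
Unset Strict Implicit.
Unset Printing Implicit Defensive.

Import Order.TTheory GRing.Theory Num.Theory.
Import numFieldNormedType.Exports.

Local Open Scope classical_set_scope.
Local Open Scope ring_scope.

(* A Polish space is given by a complete separable metric; [hausdorff_space]
   turns the pseudometric of the library into a metric. *)
Definition standard_borel (R : realType) (d : measure_display)
    (X : measurableType d) : Prop :=
  exists P : completePseudoMetricType R,
    [/\ hausdorff_space P, exists2 D : set P, countable D & dense D &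
        exists2 f : X -> P, set_bij setT setT f &
          forall A : set X, measurable A <-> <<s @open P >> (f @` A)].

Definition nonatomic (R : realType) (d : measure_display)
    (X : measurableType d) (mu : set X -> \bar R) : Prop :=
  forall A : set X, measurable A -> (0 < mu A)%E ->
    exists B : set X, [/\ measurable B, B `<=` A & (0 < mu B < mu A)%E].

Definition quasi_invariant (R : realType) (d : measure_display)
    (X : measurableType d) (sigma : X -> X) (mu : set X -> \bar R) : Prop :=
  forall A : set X, measurable A -> mu A = 0%E <-> mu (sigma @^-1` A) = 0%E.

Definition pullback_measurable (R : realType) (d : measure_display)
    (X : measurableType d) (sigma : X -> X) (g : X -> R) : Prop :=
  forall B : set R, measurable B ->
    preimage_set_system setT sigma measurable (g @^-1` B).

Definition is_cond_exp (R : realType) (d : measure_display)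
    (X : measurableType d) (mu : {measure set X -> \bar R}) (sigma : X -> X)
    (g e : X -> R) : Prop :=
  [/\ pullback_measurable sigma e,
      mu.-integrable setT (EFin \o e) &
      forall B : set X, measurable B ->
        (\int[mu]_(x in sigma @^-1` B) (e x)%:E =
         \int[mu]_(x in sigma @^-1` B) (g x)%:E)%E].

(* A version of the conditional expectation of [g] given the preimage
   sigma-algebra; the default value is irrelevant when [g] is integrable,
   because a version then exists. *)
Definition cond_exp (R : realType) (d : measure_display)
    (X : measurableType d) (mu : {measure set X -> \bar R}) (sigma : X -> X)
    (g : X -> R) : X -> R :=
  xget (cst 0) [set e | is_cond_exp mu sigma g e].

Definition markovian (R : realType) (d : measure_display)
    (X : measurableType d) (sigma : X -> X) (lambda : {measure set X -> \bar R})
    (phi : X -> R) : Prop :=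
  measurable_fun setT phi /\
  forall f : X -> R, lambda.-integrable setT (EFin \o f) ->
    lambda.-integrable setT (EFin \o ((f \o sigma) \* phi)) /\
    (\int[lambda]_x (f (sigma x) * phi x)%:E = \int[lambda]_x (f x)%:E)%E.

(* The identity defining [markovian] only constrains the conditional
   expectation of [phi]: adding a function with zero conditional expectation
   preserves it.  The comparison of densities identifies the functions
   themselves, so it is about Markovian functions that are measurable, up to a
   null set, for the preimage sigma-algebra. *)
Definition markovian_pullback (R : realType) (d : measure_display)
    (X : measurableType d) (sigma : X -> X) (lambda : {measure set X -> \bar R})
  : set (X -> R) :=
  [set phi | markovian sigma lambda phi /\
     exists2 g : X -> R, pullback_measurable sigma g & phi = g %[ae lambda]].

(* [r] induces mutually inverse bijections between [A] and [B] modulo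
   [mu]-almost everywhere equality.  Uniqueness is among all measurable
   functions, so that the partner is determined by [r] alone. *)
Definition ae_bijective_rel (R : realType) (d : measure_display)
    (X : measurableType d) (mu : {measure set X -> \bar R})
    (A B : set (X -> R)) (r : (X -> R) -> (X -> R) -> Prop) : Prop :=
  (forall a, A a -> exists b : X -> R,
     [/\ B b, r a b &
         forall b', measurable_fun setT b' -> r a b' -> b' = b %[ae mu]]) /\
  (forall b, B b -> exists a : X -> R,
     [/\ A a, r a b &
         forall a', measurable_fun setT a' -> r a' b -> a' = a %[ae mu]]).

(* Main.v *)
Require Import Defs.
From HB Require Import structures.
From mathcomp Require Import all_boot all_order all_algebra.
From mathcomp Require Import all_classical all_reals all_analysis.
From mathcomp Require Import measurable_realfun.

Set Implicit Arguments.
Unset Strict Implicit.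
Unset Printing Implicit Defensive.

Import Order.TTheory GRing.Theory Num.Theory.
Import numFieldNormedType.Exports.

Local Open Scope classical_set_scope.
Local Open Scope ring_scope.

(** A function [phi] that is measurable for the preimage sigma-algebra has the
    form [p \o sigma].  For such a [phi], the identity defining a Markovian
    function for [la] says, after a change of variables along [sigma], that
    [f * p] integrates against the image measure [distribution la sigma] to
    the integral of [f] against [la], for every integrable [f]: in other
    words, [p] is the Radon-Nikodym derivative of [la] with respect to
    [distribution la sigma] ([rn_derivative_markovian],
    [markovian_rn_derivative]).  Up to null sets there is thus exactly one
    such Markovian function for each measure.  In the same way, the
    conditional expectation of [h] is [k \o sigma], where [k] is the derivative
    of the image of [nu] with respect to the image of [mu]
    ([cond_exp_rn_derivative]).

    Write [nu'] and [mu'] for the image measures, [psi = q \o sigma] and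
    [phi = p \o sigma].  The chain rule computes the derivative of [nu] with
    respect to [mu'] in two ways: through [nu'] it is [q * k], through [mu] it
    is [h * p].  By uniqueness of derivatives these agree [mu']-almost
    everywhere, and composing with [sigma] gives the identity
    [cond_exp mu sigma h * psi = phi * (h \o sigma)].

    For the correspondence, Markovian functions exist on both sides because
    quasi-invariance makes [mu] absolutely continuous with respect to [mu'],
    and [nu], equivalent to [mu] since [h] is positive, absolutely continuous
    with respect to [nu'].  The partner is determined by the identity because
    both multipliers vanish only on null sets: [h \o sigma] by
    quasi-invariance, and [k \o sigma] because [mu'] and [nu'] are
    equivalent, so that [k] has an inverse derivative
    ([rn_derivative_neq0]). *)

(** * Radon-Nikodym derivatives *)

(** The derivative is characterized by integrals of all integrable functions
    rather than by measures of sets: this is the form in which the Markovian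
    identity presents it, and it makes the chain rule immediate. *)
Definition rn_derivative (R : realType) (d : measure_display)
    (X : measurableType d) (la rho : {measure set X -> \bar R}) (g : X -> R)
  : Prop :=
  measurable_fun setT g /\
  forall f : X -> R, la.-integrable setT (EFin \o f) ->
    rho.-integrable setT (EFin \o (f \* g)) /\
    (\int[rho]_x (f x * g x)%:E = \int[la]_x (f x)%:E)%E.

Section Integrability.
Context (R : realType) (d : measure_display) (X : measurableType d).

Lemma integrable_ae_eq (rho : {measure set X -> \bar R}) (f g : X -> \bar R) :
  measurable_fun setT g -> f = g %[ae rho] ->
  rho.-integrable setT f -> rho.-integrable setT g.
Proof.
move=> mg fg fi; apply/integrableP; split => //.
have /integrableP[mf] := fi; congr (_ < _)%E.
by apply: ae_eq_integral => //; [exact: measurableT_comp..|exact: ae_eq_abse].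
Qed.

Lemma integrable_restrict_EFin (rho : {measure set X -> \bar R})
    (f : X -> R) (A : set X) : measurable A ->
  rho.-integrable setT (EFin \o f) -> rho.-integrable setT (EFin \o (f \_ A)).
Proof.
move=> mA fi; rewrite -restrict_EFin; apply/(integrable_mkcond _ mA).
exact: integrableS fi.
Qed.

Lemma integral_restrict_EFin (rho : {measure set X -> \bar R})
    (f : X -> R) (A : set X) :
  (\int[rho]_x ((f \_ A) x)%:E = \int[rho]_(x in A) (f x)%:E)%E.
Proof.
rewrite [RHS]integral_mkcond; apply: eq_integral => x _.
by rewrite !patchE; case: ifPn.
Qed.

End Integrability.

Section RadonNikodym.
Context (R : realType) (d : measure_display) (X : measurableType d).

Lemma rn_derivative_set (la rho : {measure set X -> \bar R}) (f g : X -> R)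
    (A : set X) :
  rn_derivative la rho g -> measurable A -> la.-integrable setT (EFin \o f) ->
  (\int[rho]_(x in A) (f x * g x)%:E = \int[la]_(x in A) (f x)%:E)%E.
Proof.
move=> [mg gE] mA fi.
have [_] := gE _ (integrable_restrict_EFin mA fi).
rewrite integral_restrict_EFin => <-.
rewrite -(@integral_restrict_EFin _ _ _ rho (f \* g)).
apply: eq_integral => x _; congr EFin.
by rewrite !patchE; case: ifPn; rewrite ?mul0r.
Qed.

Lemma rn_derivative_finite (la : {finite_measure set X -> \bar R})
    (rho : {measure set X -> \bar R}) (g : X -> R) :
  rn_derivative la rho g ->
  rho.-integrable setT (EFin \o g) /\
  forall A, measurable A -> (\int[rho]_(x in A) (g x)%:E = la A)%E.
Proof.
move=> rng; have i1 : la.-integrable setT (EFin \o cst 1).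
  exact: finite_measure_integrable_cst.
split.
  have [+ _] := rng.2 _ i1; congr (rho.-integrable _ _).
  by apply/funext => x /=; rewrite mul1r.
move=> A mA; have := rn_derivative_set rng mA i1.
have -> : (\int[la]_(x in A) (cst 1%R x)%:E = la A)%E.
  by rewrite -[RHS]mul1e -integral_cst.
by move=> <-; apply: eq_integral => x _; rewrite mul1r.
Qed.

(** Both functions integrate over every measurable set to its [la]-measure,
    and finiteness of [la] makes them integrable. *)
Lemma rn_derivative_uniq (la : {finite_measure set X -> \bar R})
    (rho : {measure set X -> \bar R}) (g k : X -> R) :
  rn_derivative la rho g -> rn_derivative la rho k -> g = k %[ae rho].
Proof.
move=> /[dup] -[mg _] /rn_derivative_finite[gi gA].
move=> /[dup] -[mk _] /rn_derivative_finite[ki kA].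
have : EFin \o g = EFin \o k %[ae rho].
  apply: integral_ae_eq => //; first exact/measurable_EFinP.
  by move=> A _ mA; rewrite gA// kA.
by apply: filterS => x /= /[apply] -[].
Qed.

(** If [f] is [la]-integrable then [f * g] is [rho]-integrable, so that the
    property of [k] applies to it. *)
Lemma rn_derivative_chain (la rho tau : {measure set X -> \bar R})
    (g k : X -> R) :
  rn_derivative la rho g -> rn_derivative rho tau k ->
  rn_derivative la tau (g \* k).
Proof.
move=> [mg gE] [mk kE]; split; first exact: measurable_funM.
move=> f /gE[/kE[fgki fgkE] fgE].
have fgkA : f \* g \* k = f \* (g \* k).
  by apply/funext => x /=; rewrite mulrA.
split; first by rewrite -fgkA.
by rewrite -fgE -fgkE; apply: eq_integral => x _ /=; rewrite mulrA.
Qed.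

Lemma rn_derivative_refl (la : {measure set X -> \bar R}) :
  rn_derivative la la (cst 1).
Proof.
split=> // f fi; split; last by apply: eq_integral => x _; rewrite mulr1.
by congr (la.-integrable _ _): fi; apply/funext => x /=; rewrite mulr1.
Qed.

(** The sign of [g] is not constrained pointwise, so integrals of [f * g] are
    not accessible to monotone convergence; [g] is first identified almost
    everywhere with a nonnegative Radon-Nikodym derivative, for which change
    of variables is known. *)
Lemma density_rn_derivative (la : {finite_measure set X -> \bar R})
    (rho : {sigma_finite_measure set X -> \bar R}) (g : X -> R) :
  measurable_fun setT g ->
  (forall A, measurable A -> la A = \int[rho]_(x in A) (g x)%:E)%E ->
  rn_derivative la rho g.
Proof.
move=> mg gE; split=> // f fi.
have larho : la `<< rho.
  apply/null_content_dominatesP => A mA rhoA0.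
  by rewrite gE// null_set_integral//; exact/measurable_funTS/measurable_EFinP.
pose k := Radon_Nikodym_SigmaFinite.f la rho.
have ki : rho.-integrable setT k.
  exact: Radon_Nikodym_SigmaFinite.f_integrable.
have kg : k = EFin \o g %[ae rho].
  apply: integral_ae_eq => //; first exact/measurable_EFinP.
  by move=> A _ mA; rewrite -gE// -Radon_Nikodym_SigmaFinite.f_integral.
have mf := measurable_int _ fi.
have mk := measurable_int _ ki.
have mfg : measurable_fun setT (f \* g).
  by apply: measurable_funM => //; exact/measurable_EFinP.
split.
  apply: (le_integrable measurableT (g := abse \o (EFin \o (f \* g)))).
  - exact/measurable_EFinP.
  - by move=> x _; rewrite /= normr_id.
  have := Radon_Nikodym_SigmaFinite.integrableM larho
    (fun x => abse_ge0 (f x)%:E) measurableT (integrable_abse fi).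
  apply: integrable_ae_eq; first exact/measurableT_comp/measurable_EFinP.
  apply: filterS kg => x kgx _.
  have k0 : (0 <= k x)%E by exact: Radon_Nikodym_SigmaFinite.f_ge0.
  transitivity (`|(f x)%:E| * `|(g x)%:E|)%E; last by rewrite -abseM.
  by rewrite -[(g x)%:E]kgx// (gee0_abs k0).
rewrite -(Radon_Nikodym_change_of_variables larho measurableT fi).
apply: ae_eq_integral => //; first exact/measurable_EFinP.
  exact: emeasurable_funM.
have kr := ae_eq_Radon_Nikodym_SigmaFinite larho measurableT.
apply: filterS2 kg kr => x /(_ I) /= kgx /(_ I) <- _.
by rewrite -/k kgx EFinM.
Qed.

Lemma rn_derivative_exists (la : {finite_measure set X -> \bar R})
    (rho : {sigma_finite_measure set X -> \bar R}) :
  la `<< rho -> exists g, rn_derivative la rho g.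
Proof.
move=> larho; have [k [k0 kfin ki kE]] := radon_nikodym_sigma_finite larho.
have kK x : (fine (k x))%:E = k x by rewrite fineK.
exists (fine \o k); apply: density_rn_derivative.
  exact: measurableT_comp (measurable_int _ ki).
by move=> A mA; rewrite kE//; apply: eq_integral => x _; rewrite /= kK.
Qed.

(** By the chain rule the product of [g] with the derivative of [rho] with
    respect to [la] is the derivative of [rho] with respect to itself, which
    is 1. *)
Lemma rn_derivative_neq0 (la : {finite_measure set X -> \bar R})
    (rho : {finite_measure set X -> \bar R}) (g : X -> R) :
  rn_derivative la rho g -> rho `<< la -> {ae rho, forall x, g x != 0}.
Proof.
move=> rng /(@rn_derivative_exists rho la)[k rnk].
have := rn_derivative_uniq (rn_derivative_chain rnk rng)
  (rn_derivative_refl rho).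
apply: filterS => x /(_ I) /=; apply: contra_eq_neq => ->.
by rewrite mulr0 eq_sym oner_neq0.
Qed.

Lemma gt0_density_null_dominates (la rho : {measure set X -> \bar R})
    (g : X -> R) :
  measurable_fun setT g -> {ae rho, forall x, 0 < g x} ->
  (forall A, measurable A -> la A = \int[rho]_(x in A) (g x)%:E)%E ->
  rho `<< la.
Proof.
move=> mg g_gt0 gE; apply/null_content_dominatesP => A mA.
have mgA : measurable_fun A (EFin \o g).
  exact/measurable_funTS/measurable_EFinP.
move=> laA0.
have : (\int[rho]_(x in A) `|(EFin \o g) x| = 0)%E.
  rewrite -[RHS](_ : la A = 0%E)// gE//; apply: ae_eq_integral => //.
    exact: measurableT_comp.
  by apply: filterS g_gt0 => x gx _ /=; rewrite gtr0_norm.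
move=> /(ae_eq_integral_abs rho mA mgA) g0.
apply/negligibleP => //; rewrite -(setCK A).
suff : \forall x \ae rho, (~` A) x by [].
apply: filterS2 g_gt0 g0 => x gx_gt0 + Ax => /(_ Ax)[gx0].
by rewrite gx0 ltxx in gx_gt0.
Qed.

End RadonNikodym.

(** * Functions measurable for the preimage sigma-algebra *)

Section PullbackMeasurable.
Context (R : realType) (d : measure_display) (X : measurableType d).
Context (sigma : X -> X).

Lemma pullback_measurable_comp (g : X -> R) :
  measurable_fun setT g -> pullback_measurable sigma (g \o sigma).
Proof.
move=> mg B mB; exists (g @^-1` B); last by rewrite setTI.
by rewrite -[X in measurable X]setTI; exact: mg.
Qed.

(** Preimages of points under [g] are unions of fibers of [sigma], hence [g] is
    constant on fibers and factors through [sigma] by means of any section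
    [tau].  Since [sigma] is onto, a set is determined by its preimage, which
    forces preimages under the factor to be measurable even though [tau] need
    not be. *)
Lemma pullback_measurable_factor (g : X -> R) : set_surj setT setT sigma ->
  pullback_measurable sigma g ->
  exists2 k : X -> R, measurable_fun setT k & g = k \o sigma.
Proof.
move=> sigma_surj gB.
have [tau tauK] : {tau : X -> X | cancel tau sigma}.
  have /choice[tau tauK] y : exists x, sigma x = y.
    by have [x _ <-] := sigma_surj y I; exists x.
  by exists tau.
have gE : g = (g \o tau) \o sigma.
  apply/funext => x /=.
  have [A mA] := gB [set g x] (measurable_set1 (g x)).
  rewrite setTI => /seteqP[sAg gsA].
  by rewrite [RHS](sAg (tau (sigma x)))//= tauK; exact: (gsA x).
exists (g \o tau) => // _ B mB; rewrite setTI.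
have [A mA] := gB B mB; rewrite setTI => sAg.
suff -> : (g \o tau) @^-1` B = A by [].
apply/seteqP; split => y.
  move=> Bgy; have : (sigma @^-1` A) (tau y) by rewrite sAg.
  by rewrite /= tauK.
by move=> Ay; have : (g @^-1` B) (tau y) by rewrite -sAg /= tauK.
Qed.

End PullbackMeasurable.

(** * Markovian functions and conditional expectations as derivatives *)

Section Markovian.
Context (R : realType) (d : measure_display) (X : measurableType d).
Context (sigma : {mfun X >-> X}).

Lemma ae_distribution (la : probability X R) (P : X -> Prop) :
  {ae distribution la sigma, forall y, P y} ->
  {ae la, forall x, P (sigma x)}.
Proof.
move=> [N [mN N0 PN]]; exists (sigma @^-1` N); split => //.
- exact: measurable_funPTI.
- by move=> x; exact: PN.
Qed.

(** Changing [phi] on a null set, [f \o sigma * phi] becomes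
    [(f * p) \o sigma], whose integral transfers to the image measure. *)
Lemma rn_derivative_markovian (la : probability X R) (phi p : X -> R) :
  measurable_fun setT p -> phi = p \o sigma %[ae la] ->
  markovian sigma la phi -> rn_derivative la (distribution la sigma) p.
Proof.
move=> mp phip [mphi phiE]; split=> // f fi.
have mf : measurable_fun setT f by exact/measurable_EFinP/(measurable_int la).
have [fphi <-] := phiE f fi.
have mfp : measurable_fun setT (EFin \o (f \* p)).
  by apply/measurable_EFinP; exact: measurable_funM.
have fphip : EFin \o ((f \o sigma) \* phi) =
             EFin \o (f \* p) \o sigma %[ae la].
  by apply: filterS phip => x /= /[apply] ->.
have fpi : la.-integrable setT (EFin \o (f \* p) \o sigma).
  by apply: integrable_ae_eq fphip fphi; exact: measurableT_comp.
split; first exact: integrable_pushforward.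
rewrite (integral_distribution mfp fpi).
apply: ae_eq_integral => //; first exact: measurableT_comp.
  exact: measurable_int fphi.
exact: ae_eq_sym.
Qed.

Lemma markovian_rn_derivative (la : probability X R) (p : X -> R) :
  rn_derivative la (distribution la sigma) p ->
  markovian_pullback sigma la (p \o sigma).
Proof.
move=> [mp pE]; split; last first.
  exists (p \o sigma); first exact: pullback_measurable_comp.
  exact: ae_eq_refl.
split=> [|f fi]; first exact: measurableT_comp.
have [fpi fpE] := pE f fi.
have mfp := measurable_int _ fpi.
have fps : la.-integrable setT (EFin \o (f \* p) \o sigma).
  apply/integrableP; split; first exact: measurableT_comp.
  have /integrableP[_] := fpi; rewrite ge0_integral_distribution//.
  exact: measurableT_comp.
by split=> //; rewrite -fpE (integral_distribution mfp fps).
Qed.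

Lemma markovian_pullbackP (la : probability X R) (phi : X -> R) :
  set_surj setT setT sigma -> markovian_pullback sigma la phi ->
  exists2 p, rn_derivative la (distribution la sigma) p &
             phi = p \o sigma %[ae la].
Proof.
move=> sigma_surj [phiM [g gB phig]].
have [p mp gE] := pullback_measurable_factor sigma_surj gB.
rewrite gE in phig.
by exists p => //; exact: rn_derivative_markovian phiM.
Qed.

(** Integrals over [sigma @^-1` B] of functions composed with [sigma] are
    integrals over [B] against image measures, so the averaging property of
    conditional expectations is the density property of [e]. *)
Lemma is_cond_exp_rn_derivative (mu nu : probability X R) (h e : X -> R) :
  rn_derivative nu mu h ->
  rn_derivative (distribution nu sigma) (distribution mu sigma) e ->
  is_cond_exp mu sigma h (e \o sigma).
Proof.
move=> rnh rne; have me := rne.1; have [ei eA] := rn_derivative_finite rne.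
have [hi hA] := rn_derivative_finite rnh.
have ies : mu.-integrable setT (EFin \o e \o sigma).
  apply/integrableP; split; first by do 2 apply: measurableT_comp => //.
  have /integrableP[mE] := ei; rewrite ge0_integral_distribution//.
  exact: measurableT_comp.
split=> //; first exact: pullback_measurable_comp.
move=> B mB; rewrite hA; last exact: measurable_funPTI.
rewrite -[RHS](eA B mB) integral_pushforward//.
- exact/measurable_EFinP.
- by apply: integrableS ies => //; exact: measurable_funPTI.
Qed.

Lemma rn_derivative_is_cond_exp (mu nu : probability X R) (h e : X -> R) :
  set_surj setT setT sigma -> rn_derivative nu mu h ->
  is_cond_exp mu sigma h e ->
  exists2 k, rn_derivative (distribution nu sigma) (distribution mu sigma) k &
             e = k \o sigma.
Proof.
move=> sigma_surj rnh [eB ei eE]; have [hi hA] := rn_derivative_finite rnh.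
have [k mk ek] := pullback_measurable_factor sigma_surj eB; exists k => //.
apply: density_rn_derivative => // A mA.
have msA : measurable (sigma @^-1` A) by exact: measurable_funPTI.
rewrite [LHS](_ : _ = nu (sigma @^-1` A))// -hA// -eE// ek.
rewrite ek in ei.
rewrite integral_pushforward//; first exact/measurable_EFinP.
exact: integrableS ei.
Qed.

(** Existence of the derivative of the image measures provides a version of
    the conditional expectation, so that the choice made by [cond_exp] is a
    genuine version. *)
Lemma cond_exp_rn_derivative (mu nu : probability X R) (h : X -> R) :
  set_surj setT setT sigma -> rn_derivative nu mu h ->
  distribution nu sigma `<< distribution mu sigma ->
  exists2 k, rn_derivative (distribution nu sigma) (distribution mu sigma) k &
             cond_exp mu sigma h = k \o sigma.
Proof.
move=> sigma_surj rnh numu; have [e rne] := rn_derivative_exists numu.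
apply: (rn_derivative_is_cond_exp sigma_surj rnh).
have : exists e, is_cond_exp mu sigma h e.
  by exists (e \o sigma); exact: is_cond_exp_rn_derivative rnh rne.
exact: xgetPex.
Qed.

End Markovian.

(** * The correspondence of Markovian functions *)

Theorem theorem3p15 (R : realType) (d : measure_display) (X : measurableType d)
    (sigma : X -> X) (mu nu : probability X R) (h : X -> R)
    (X_borel : standard_borel R X)
    (mu_nonatomic : nonatomic mu) (nu_nonatomic : nonatomic nu)
    (sigma_meas : measurable_fun setT sigma)
    (sigma_surj : set_surj setT setT sigma)
    (mu_qi : quasi_invariant sigma mu)
    (h_meas : measurable_fun setT h)
    (h_gt0 : {ae mu, forall x, 0 < h x})
    (nu_density : forall A : set X, measurable A ->
       nu A = (\int[mu]_(x in A) (h x)%:E)%E) :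
  (forall psi phi : X -> R,
     markovian_pullback sigma nu psi -> markovian_pullback sigma mu phi ->
     cond_exp mu sigma h \* psi = phi \* (h \o sigma) %[ae mu]) /\
  ae_bijective_rel mu (markovian_pullback sigma mu) (markovian_pullback sigma nu)
    (fun phi psi => cond_exp mu sigma h \* psi = phi \* (h \o sigma) %[ae mu]).
Proof.
pose S : {mfun X >-> X} :=
  MeasurableFun.Pack
    (MeasurableFun.Class (isMeasurableFun.Build _ _ _ _ _ sigma_meas)).
have numu : nu `<< mu.
  apply/null_content_dominatesP => A mA muA0.
  rewrite nu_density// null_set_integral//.
  exact/measurable_funTS/measurable_EFinP.
have rnh : rn_derivative nu mu h by exact: density_rn_derivative nu_density.
have munu : mu `<< nu by exact: gt0_density_null_dominates nu_density.
have qi_ae (P : X -> Prop) : {ae mu, forall x, P x} ->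
    {ae mu, forall x, P (sigma x)}.
  move=> [N [mN /(mu_qi N mN).1 N0 PN]]; exists (sigma @^-1` N); split => //.
    exact: (measurable_funPTI S).
  by move=> x; exact: PN.
have msmu : mu `<< distribution mu S.
  by apply/null_content_dominatesP => A mA /(mu_qi A mA).2.
have [/null_content_dominatesP numu0 /null_content_dominatesP munu0] :=
  (numu, munu).
have snumu : distribution nu S `<< distribution mu S.
  apply/null_content_dominatesP => A mA; apply: numu0.
  exact: (measurable_funPTI S).
have smunu : distribution mu S `<< distribution nu S.
  apply/null_content_dominatesP => A mA; apply: munu0.
  exact: (measurable_funPTI S).
have nusnu : nu `<< distribution nu S.
  by apply: null_dominates_trans smunu; apply: null_dominates_trans msmu.
have [k rnk Ek] := @cond_exp_rn_derivative _ _ _ S mu nu h sigma_surj rnh snumu.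
have k_neq0 : {ae mu, forall x, k (sigma x) != 0}.
  exact: (ae_distribution (rn_derivative_neq0 rnk smunu)).
have h_neq0 : {ae mu, forall x, h (sigma x) != 0}.
  apply: (qi_ae (fun y => h y != 0)).
  by apply: filterS h_gt0 => x /lt0r_neq0.
have identity psi phi : markovian_pullback sigma nu psi ->
    markovian_pullback sigma mu phi ->
    cond_exp mu sigma h \* psi = phi \* (h \o sigma) %[ae mu].
  move=> /(@markovian_pullbackP _ _ _ S nu _ sigma_surj)[q rnq psiq].
  move=> /(@markovian_pullbackP _ _ _ S mu _ sigma_surj)[p rnp phip].
  (* the derivative of [nu] with respect to the image of [mu], computed through
     the image of [nu] and through [mu] *)
  have := rn_derivative_uniq (rn_derivative_chain rnq rnk)
    (rn_derivative_chain rnh rnp).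
  move=> /ae_distribution; move/(null_dominates_ae_eq measurableT munu): psiq.
  rewrite Ek; apply: filterS3 phip => x /= /(_ I) -> /(_ I) -> /(_ I) qkhp _.
  by rewrite mulrC qkhp mulrC.
split=> //; split=> [phi phiM|psi psiM].
  have [q rnq] := rn_derivative_exists nusnu.
  have psiM := markovian_rn_derivative rnq.
  exists (q \o sigma); split=> //; first exact: identity.
  move=> psi' _ psi'E; have psiE := identity _ _ psiM phiM.
  rewrite Ek in psi'E psiE.
  apply: filterS3 k_neq0 psi'E psiE => x k0 /= /(_ I) <- /(_ I) + _.
  by move=> /(mulfI k0).
have [p rnp] := rn_derivative_exists msmu.
have phiM := markovian_rn_derivative rnp.
exists (p \o sigma); split=> //; first exact: identity.
move=> phi' _ phi'E; have phiE := identity _ _ psiM phiM.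
apply: filterS3 h_neq0 phi'E phiE => x h0 /= /(_ I) -> /(_ I) + _.
by move=> /(mulIf h0).
Qed.
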